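(* Let $(x^{*},y^{*})$ be a saddle-point of $f$, and let $((x^k,y^k))_{k\in\mathbf N}$ be generated by the alternating proximal mapping method. Suppose $\inf_{k\in\mathbf N}\tau_k>0$ and $\inf_{k\in\mathbf N}\sigma_k>0$. Let $\xi\in(0,1)$ be such that $\xi\,\sup_{k\in\mathbf N}\tau_k\,\sup_{k\in\mathbf N}\sigma_k\,\|K\|^2<1$. Let $\eta_4\in\mathbf R_{++}$ be such that $\eta_4\ge\sup_{i\in\mathbf N}\tau_i$ and $\frac1{\sup_{i\in\mathbf N}\sigma_i}-\xi\eta_4\|K\|^2>0$. Let $\eta_1,\eta_2,\eta_3\in\mathbf R_{++}$ be such that one of the following holds. (a) $\mu\ge\frac1{\xi\inf_{k\in\mathbf N}\tau_k}-\frac1{\sup_{k\in\mathbf N}\tau_k}+\eta_3\|K\|\sup_{k\in\mathbf N}\beta_k^2$, $\ \nu\ge\frac1{\xi\inf_{k\in\mathbf N}\sigma_k}-\frac1{\sup_{k\in\mathbf N}\sigma_k}+\eta_2\|K\|\sup_{k\in\mathbf N}(\xi-\alpha_k)^2$, $\ \|K\|\big(\eta_1\xi^2+\frac1{\eta_2}\big)\le\frac{\xi}{\sup_{i\in\mathbf N}\tau_i}$, and $\|K\|\big(\frac1{\eta_1}+\frac1{\eta_3}\big)\le\frac1{\sup_{i\in\mathbf N}\sigma_i}$. (b) $\mu\ge\frac1{\xi\inf_{k\in\mathbf N}\tau_k}-\frac1{\sup_{k\in\mathbf N}\tau_k}+\eta_3\|K\|^2\sup_{k\in\mathbf N}\beta_k^2$,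 $\ \nu\ge\frac1{\xi\inf_{k\in\mathbf N}\sigma_k}-\frac1{\sup_{k\in\mathbf N}\sigma_k}+\eta_2\|K\|^2\sup_{k\in\mathbf N}(\xi-\alpha_k)^2$, $\ \eta_1\|K\|^2\xi+\frac1{\eta_2\xi}\le\frac1{\sup_{k\in\mathbf N}\tau_k}$, and $\frac1{\eta_1}+\frac1{\eta_3}\le\frac1{\sup_{k\in\mathbf N}\sigma_k}$. For $k\in\mathbf N$ set $\hat x_k=\frac1{\sum_{j=0}^k\xi^{-j}}\sum_{i=0}^k\xi^{-i}x^{i+1}$ and $\hat y_k=\frac1{\sum_{j=0}^k\xi^{-j}}\sum_{i=0}^k\xi^{-i}y^{i+1}$. Then there exists $M\in\mathbf R_{++}$ such that for every $k\in\mathbf N$, $$f(\hat x_k,\hat y_k)-f(x^*,y^* )\le\xi^k\Big(\frac1{2\tau_0}\|x^*-x^0\|^2+\frac1{2\sigma_0}\|\hat y_k-y^0\|^2\Big)\le\xi^kM,$$ $$f(x^*,y^* )-f(\hat x_k,\hat y_k)\le\xi^k\Big(\frac1{2\tau_0}\|\hat x_k-x^0\|^2+\frac1{2\sigma_0}\|y^*-y^0\|^2\Big)\le\xi^kM.$$ Consequently, $(f(\hat x_k,\hat y_k))_{k\in\mathbf N}$ converges linearly to $f(x^*,y^* )$ with rate $\xi\in(0,1)$.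
   Context: $\mathbf N=\{0,1,2,\dots\}$, $\mathbf R_+=[0,\infty)$, $\mathbf R_{++}=(0,\infty)$. $\mathcal H_1,\mathcal H_2$ are real Hilbert spaces; $K:\mathcal H_1\to\mathcal H_2$ is a continuous linear operator with operator norm $\|K\|$ and adjoint $K^*$. $g:\mathcal H_1\to\mathbf R\cup\{+\infty\}$ and $h:\mathcal H_2\to\mathbf R\cup\{+\infty\}$ are proper and lower semicontinuous; $\mu,\nu\in\mathbf R_{++}$; $g$ is strongly convex with modulus $\mu$, i.e. $\langle u,x-\bar x\rangle+\frac\mu2\|x-\bar x\|^2+g(\bar x)\le g(x)$ for all $\bar x\in\operatorname{dom}\partial g$, $u\in\partial g(\bar x)$, $x\in\mathcal H_1$; and $h$ is strongly convex with modulus $\nu$ (same inequality with $h,\nu,\mathcal H_2$). Define $f(x,y)=\langle Kx,y\rangle+g(x)-h(y)$ on $\mathcal H_1\times\mathcal H_2$. A saddle-point of $f$ is $(x^*,y^* )$ with $f(x^*,y)\le f(x^*,y^* )\le f(x,y^* )$ for all $x\in\mathcal H_1,y\in\mathcal H_2$; one is assumed to exist. Alternating proximal mapping method: given sequences $(\tau_k)_{k\in\mathbf N\cup\{-1\}}$, $(\sigma_k)_{k\in\mathbf N\cup\{-1\}}$ in $\mathbf R_{++}$ and $(\alpha_k)_{k\in\mathbf N\cup\{-1\}}$, $(\beta_k)_{k\in\mathbf N\cup\{-1\}}$ in $\mathbf R_+$, and $(x^0,y^0)\in\mathcal H_1\times\mathcal H_2$, set $x^{-1}=x^0$, $y^{-1}=y^0$,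 $\bar x^0=x^0$, $\bar y^0=y^0$ and for every $k\in\mathbf N$: $y^{k+1}=\operatorname{Prox}_{\sigma_kh}(\sigma_kK\bar x^k+y^k)$; $\bar y^{k+1}=y^{k+1}+\beta_k(y^{k+1}-y^k)$; $x^{k+1}=\operatorname{Prox}_{\tau_kg}(-\tau_kK^*\bar y^{k+1}+x^k)$; $\bar x^{k+1}=x^{k+1}+\alpha_k(x^{k+1}-x^k)$. Here $\operatorname{Prox}_\varphi(z)=\operatorname{argmin}_w(\varphi(w)+\frac12\|z-w\|^2)$. *)

(* Defs.v *)
From HB Require Import structures.
From mathcomp Require Import all_boot all_order all_algebra.
From mathcomp Require Import sesquilinear.
From mathcomp Require Import all_classical all_reals all_analysis.

Set Implicit Arguments.
Unset Strict Implicit.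
Unset Printing Implicit Defensive.

Import Order.TTheory GRing.Theory Num.Theory.
Import numFieldNormedType.Exports.

Local Open Scope classical_set_scope.
Local Open Scope ring_scope.

(* Real Hilbert spaces: complete normed modules over the reals whose norm is
   induced by a positive definite symmetric bilinear form. *)
HB.mixin Record isHilbert (R : realType) H & CompleteNormedModule R H := {
  inner : {dot H for (@idfun R)};
  inner_sqr_norm : forall x : H, inner x x = `|x| ^+ 2
}.

#[short(type="hilbertType")]
HB.structure Definition Hilbert (R : realType) :=
  {H of isHilbert R H & CompleteNormedModule R H}.

Notation "''[' x , y ]" := (inner x y) : ring_scope.

Section hilbert.
Context {R : realType}.

Definition opnorm {V W : normedModType R} (K : V -> W) : R :=
  sup [set `|K x| | x in [set x : V | `|x| <= 1]].

(* In Hilbert spaces a continuous linear [K] has exactly one such [Ks]. *)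
Definition is_adjoint {H1 H2 : hilbertType R} (K : H1 -> H2) (Ks : H2 -> H1) :=
  forall x y, '[K x, y] = '[x, Ks y].

Definition proper_fun {T : Type} (phi : T -> \bar R) :=
  (forall x, phi x != -oo%E) /\ (exists x, (phi x < +oo)%E).

Definition subdiff {H : hilbertType R} (phi : H -> \bar R) (x : H) : set H :=
  [set u | forall y, ('[u, y - x]%:E + phi x <= phi y)%E].

Definition strongly_convex {H : hilbertType R} (mu : R) (phi : H -> \bar R) :=
  forall xb u x, subdiff phi xb u ->
    ('[u, x - xb]%:E + (mu / 2 * `|x - xb| ^+ 2)%:E + phi xb <= phi x)%E.

(* The set of minimizers of [w |-> phi w + 1/2 * |z - w|^2]. *)
Definition Prox {H : hilbertType R} (phi : H -> \bar R) (z : H) : set H :=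
  [set p | forall w, (phi p + (2^-1 * `|z - p| ^+ 2)%:E
                      <= phi w + (2^-1 * `|z - w| ^+ 2)%:E)%E].

(* When [g x = h y = +oo] the library's convention [+oo - +oo = -oo] applies;
   for proper [g] and [h], no saddle-point is of that kind. *)
Definition lagrangian {H1 H2 : hilbertType R} (K : H1 -> H2)
    (g : H1 -> \bar R) (h : H2 -> \bar R) (x : H1) (y : H2) : \bar R :=
  ('[K x, y]%:E + g x - h y)%E.

Definition saddle_point {T1 T2 : Type} (f : T1 -> T2 -> \bar R)
    (xs : T1) (ys : T2) :=
  forall x y, (f xs y <= f xs ys)%E /\ (f xs ys <= f x ys)%E.

(* Index [-1] is omitted: since x^{-1} = x^0 and y^{-1} = y^0, the entries of
   the parameter sequences at [-1] do not enter the iteration. *)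
Record alternating_proximal {H1 H2 : hilbertType R}
    (K : H1 -> H2) (Ks : H2 -> H1) (g : H1 -> \bar R) (h : H2 -> \bar R)
    (tau sigma alpha beta : nat -> R)
    (x xbar : nat -> H1) (y ybar : nat -> H2) : Prop := AlternatingProximal {
  apm_xbar0 : xbar 0%N = x 0%N;
  apm_ybar0 : ybar 0%N = y 0%N;
  apm_y : forall k, Prox (fun w => ((sigma k)%:E * h w)%E)
                         (sigma k *: K (xbar k) + y k) (y k.+1);
  apm_ybar : forall k, ybar k.+1 = y k.+1 + beta k *: (y k.+1 - y k);
  apm_x : forall k, Prox (fun w => ((tau k)%:E * g w)%E)
                         (- (tau k *: Ks (ybar k.+1)) + x k) (x k.+1);
  apm_xbar : forall k, xbar k.+1 = x k.+1 + alpha k *: (x k.+1 - x k)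
}.

(* Extended-real valued, so that unbounded sequences have supremum [+oo]. *)
Definition supE (u : nat -> R) : \bar R := ereal_sup [set (u k)%:E | k in setT].
Definition infE (u : nat -> R) : \bar R := ereal_inf [set (u k)%:E | k in setT].

Definition ergodic {H : hilbertType R} (xi : R) (x : nat -> H) (k : nat) : H :=
  (\sum_(0 <= j < k.+1) xi ^- j)^-1 *: \sum_(0 <= i < k.+1) xi ^- i *: x i.+1.

(* R-linear convergence; the bound forces [l] and every [u k] to be finite. *)
Definition linear_cvg (u : nat -> \bar R) (l : \bar R) (xi : R) :=
  [/\ 0 < xi < 1, u @ \oo --> l &
      exists2 C : R, 0 < C & forall k, (`|u k - l| <= (C * xi ^+ k)%:E)%E].

End hilbert.

(* Main.v *)
(* Summing the prox inequalities of [g] and [h] with weights [xi^-k], the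
   bilinear terms telescope and the remaining ones are absorbed by Young's
   inequality under either (a) or (b), so that the weighted primal-dual gap is
   at most the initial squared distances; dividing by the total weight, which
   is at least [xi^-k], and applying Jensen's inequality gives the rate [xi^k].

   Convexity of [g] and [h] is not a hypothesis: [strongly_convex] only speaks
   about points of the domain of the subdifferential. It has to be derived, as
   both Jensen's inequality and the subgradient at a prox point rely on it. A
   saddle point provides a subgradient, hence a quadratic minorant; a smooth
   variational principle then makes the range of the subdifferential dense, and
   strong monotonicity makes it closed, hence the whole space. By Banach's
   fixed point theorem [p + t u = z] is solvable with [u] a subgradient at [p]
   for all [z] and [t > 0], from which both facts follow. *)

Require Import Defs.
From mathcomp Require Import all_boot all_order all_algebra.
From mathcomp Require Import sesquilinear ring lra.
From mathcomp Require Import all_classical all_reals all_analysis.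

Set Implicit Arguments.
Unset Strict Implicit.
Unset Printing Implicit Defensive.

Import Order.TTheory GRing.Theory Num.Theory.
Import numFieldNormedType.Exports.

Local Open Scope classical_set_scope.
Local Open Scope ring_scope.

(** * Hilbert spaces *)

Section hilbert_space.
Context {R : realType} {H : hilbertType R}.
Implicit Types (x y z : H) (a : R).

Lemma innerDl x y z : '[x + y, z] = '[x, z] + '[y, z].
Proof. exact: linearDl. Qed.

Lemma innerDr x y z : '[x, y + z] = '[x, y] + '[x, z].
Proof. exact: linearDr. Qed.

Lemma innerNl x y : '[- x, y] = - '[x, y].
Proof. exact: linearNl. Qed.

Lemma innerNr x y : '[x, - y] = - '[x, y].
Proof. exact: linearNr. Qed.

Lemma innerZl a x y : '[a *: x, y] = a * '[x, y].
Proof. exact: linearZl_LR. Qed.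

Lemma innerZr a x y : '[x, a *: y] = a * '[x, y].
Proof. exact: linearZr_LR. Qed.

Lemma innerC x y : '[x, y] = '[y, x].
Proof. by rewrite hermC expr0 mul1r. Qed.

Lemma inner0l x : '[0, x] = 0.
Proof. exact: linear0l. Qed.

Lemma inner_sumr (I : Type) (r : seq I) x (F : I -> H) :
  '[x, \sum_(i <- r) F i] = \sum_(i <- r) '[x, F i].
Proof. exact: linear_sumr. Qed.

Definition innerE := (innerDl, innerDr, innerNl, innerNr, innerZl, innerZr).

Lemma sqr_norm_inner x : `|x| ^+ 2 = '[x, x].
Proof. by rewrite inner_sqr_norm. Qed.

Lemma sqr_normD x y : `|x + y| ^+ 2 = `|x| ^+ 2 + 2 * '[x, y] + `|y| ^+ 2.
Proof. rewrite !sqr_norm_inner !innerE (innerC y x); ring. Qed.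

Lemma sqr_normB x y : `|x - y| ^+ 2 = `|x| ^+ 2 - 2 * '[x, y] + `|y| ^+ 2.
Proof. rewrite !sqr_norm_inner !innerE (innerC y x); ring. Qed.

Lemma inner_polar x y : '[x, y] = 2^-1 * (`|x + y| ^+ 2 - `|x| ^+ 2 - `|y| ^+ 2).
Proof. rewrite sqr_normD; lra. Qed.

Lemma cauchy_schwarz x y : '[x, y] <= `|x| * `|y|.
Proof.
have /(lerXn2r 2) := ler_normD x y.
rewrite !nnegrE !addr_ge0// => /(_ (normr_ge0 _) isT).
rewrite sqr_normD sqrrD; lra.
Qed.

(** Polarization reduces joint continuity of the inner product to continuity of the norm. *)
Lemma cvg_inner (u v : nat -> H) x y : u @ \oo --> x -> v @ \oo --> y ->
  '[u n, v n] @[n --> \oo] --> '[x, y].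
Proof.
move=> ux vy; under eq_fun do rewrite inner_polar.
have sq (w : nat -> H) z : w @ \oo --> z ->
    `|w n| ^+ 2 @[n --> \oo] --> `|z| ^+ 2.
  by move=> /cvg_norm wz; rewrite expr2; under eq_fun do rewrite expr2;
     exact: cvgM.
rewrite inner_polar; apply: cvgMr; apply: cvgB; last exact: sq.
by apply: cvgB; apply: sq => //; exact: cvgD.
Qed.

(** The increments form an absolutely convergent series, so completeness yields a limit. *)
Lemma geometric_cvg (u : nat -> H) (C : R) :
  (forall n, `|u n.+1 - u n| <= C * 2^-1 ^+ n) ->
  (forall n, `|u n - u 0%N| <= 2 * C) /\ exists l : H, u @ \oo --> l.
Proof.
move=> uC; pose s n := u n.+1 - u n.
have us n : u n - u 0%N = series s n.
  by rewrite seriesEnat/= telescope_sumr.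
pose t := series (fun n => `|s n|).
have bnd n : t n <= 2 * C * (1 - 2^-1 ^+ n).
  elim: n => [|n IH]; first by rewrite /t seriesEnat/= big_geq// expr0 subrr mulr0.
  by rewrite /t seriesSr; apply: (le_trans (lerD IH (uC n))); rewrite exprS; lra.
have C0 : 0 <= C by have := le_trans (normr_ge0 _) (uC 0%N); rewrite mulr1.
have bnd2 n : t n <= 2 * C.
  apply: (le_trans (bnd n)); apply: ler_piMr; first by rewrite mulr_ge0.
  by rewrite lerBlDr lerDl exprn_ge0// invr_ge0.
split=> [n|].
  rewrite us; apply: le_trans (bnd2 n); rewrite /t !seriesEnat/=.
  exact: ler_norm_sum.
have /normed_cvg/cvg_ex[l sl] : cvgn [normed series s].
  change (cvgn t).
  apply: nondecreasing_is_cvgn.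
    by apply: nondecreasing_series => n _ _; exact: normr_ge0.
  by exists (2 * C) => _ [n _ <-].
exists (l + u 0%N).
have E : (fun n => series s n + u 0%N) = u.
  by apply/funext => n; rewrite -us subrK.
rewrite -[X in X @ _]E; apply: cvgD; [exact: sl | exact: cvg_cst].
Qed.

End hilbert_space.

Lemma cvg_dist_le {R : realType} {V : normedModType R} (u : nat -> V) (l : V)
    (c : nat -> R) :
  c @ \oo --> 0 -> (forall n, `|u n - l| <= c n) -> u @ \oo --> l.
Proof.
move=> c0 uc; apply/cvgrPdist_le => e e0; near=> n.
rewrite distrC; apply: (le_trans (uc n)); near: n; exact: (cvgr_le _ c0).
Unshelve. all: by end_near.
Qed.

Lemma cvg_half_pow {R : realType} : ((2^-1 : R) ^+ n) @[n --> \oo] --> 0.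
Proof. by apply: cvg_expr; rewrite ger0_norm ?invr_ge0// invf_lt1// ltr1n. Qed.

(** * Subdifferentials of strongly convex functions *)

Section subdifferential.
Context {R : realType} {H : hilbertType R} (g : H -> \bar R).
Implicit Types (p q u v w : H).

(** If [g z] exceeded [l], some level [a] strictly between would be exceeded by [g] near [z],
    whereas [c n < a] eventually. *)
Lemma lsc_lim (x : nat -> H) (c : nat -> R) (z : H) (l : R) :
  lower_semicontinuous g -> x @ \oo --> z -> c @ \oo --> l ->
  (forall n, (g (x n) <= (c n)%:E)%E) -> (g z <= l%:E)%E.
Proof.
move=> lsc xz cl gc; rewrite leNgt; apply/negP => lt_lg.
have [a la ag] : exists2 a, l < a & (a%:E < g z)%E.
  case: (g z) lt_lg => [r| |//]; last by exists (l + 1); rewrite ?ltrDl ?ltry.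
  by rewrite lte_fin => lr; exists ((l + r) / 2); rewrite ?lte_fin midf_lt.
have [V Vz Va] := lsc _ _ ag.
have [N _ /(_ N (leqnn N)) [VN cN]] :
    \forall n \near \oo, V (x n) /\ c n < a.
  by apply: filterI; [exact: xz | exact: (cvgr_lt _ cl)].
have := lt_le_trans (Va _ VN) (gc N).
by rewrite lte_fin => /(lt_trans cN); rewrite ltxx.
Qed.

Hypothesis g_proper : proper_fun g.

Lemma proper_fin w (r : R) : (g w <= r%:E)%E -> g w \is a fin_num.
Proof.
move=> gr; rewrite fin_real// (le_lt_trans gr) ?ltry// andbT.
by rewrite ltNye; exact: (g_proper.1 w).
Qed.

Lemma proper_dom : exists w, g w \is a fin_num.
Proof.
have [w gw] := g_proper.2; exists w; rewrite fin_real// gw andbT.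
by rewrite ltNye; exact: (g_proper.1 w).
Qed.

Lemma proper_not_fin w : g w \isn't a fin_num -> g w = +oo%E.
Proof. by have := g_proper.1 w; case: (g w). Qed.

Lemma subdiff_fin p u : subdiff g p u -> g p \is a fin_num.
Proof.
move=> sub; have [w gw] := proper_dom.
apply: (@proper_fin _ (fine (g w) - '[u, w - p])).
by rewrite EFinB fineK// leeBrDl//; exact: sub.
Qed.

Lemma subdiff_le p u w : subdiff g p u -> g w \is a fin_num ->
  '[u, w - p] + fine (g p) <= fine (g w).
Proof.
by move=> sub gw; rewrite -lee_fin EFinD !fineK ?(subdiff_fin sub)//; exact: sub.
Qed.

Lemma subdiff_intro p u : g p \is a fin_num ->
  (forall w, g w \is a fin_num -> '[u, w - p] + fine (g p) <= fine (g w)) ->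
  subdiff g p u.
Proof.
move=> gp le w; have [gw|/proper_not_fin->] := boolP (g w \is a fin_num).
  by rewrite -(fineK gp) -(fineK gw) -EFinD lee_fin; exact: le.
by rewrite leey.
Qed.

(** The inequality at [x n] reads g(x_n) <= g(w) - <v_n, w - x_n>; the right side converges, and
    lower semicontinuity carries the bound over to g(z). *)
Lemma subdiff_closed (x v : nat -> H) (z u : H) : lower_semicontinuous g ->
  x @ \oo --> z -> v @ \oo --> u -> (forall n, subdiff g (x n) (v n)) ->
  subdiff g z u.
Proof.
move=> lsc xz vu sub.
have lim w : g w \is a fin_num -> (g z <= (fine (g w) - '[u, w - z])%:E)%E.
  move=> gw; apply: (@lsc_lim x (fun n => fine (g w) - '[v n, w - x n])) => //.
    apply: cvgB; first exact: cvg_cst.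
    by apply: cvg_inner => //; apply: cvgB => //; exact: cvg_cst.
  move=> n; rewrite -(fineK (subdiff_fin (sub n))) lee_fin lerBrDl.
  exact: subdiff_le.
have gz : g z \is a fin_num.
  by have [w gw] := proper_dom; exact: proper_fin (lim w gw).
apply: subdiff_intro => // w /[dup] gw /lim.
by rewrite -{1}(fineK gz) lee_fin lerBrDl.
Qed.

Section strongly_convex.
Variable mu : R.
Hypotheses (mu_gt0 : 0 < mu) (g_sc : strongly_convex mu g).

Lemma subdiff_strong p u w : subdiff g p u -> g w \is a fin_num ->
  '[u, w - p] + mu / 2 * `|w - p| ^+ 2 + fine (g p) <= fine (g w).
Proof.
move=> sub gw; rewrite -lee_fin !EFinD !fineK ?(subdiff_fin sub)//.
by rewrite -EFinD; exact: g_sc.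
Qed.

Lemma subdiff_strong_monotone p q u v : subdiff g p u -> subdiff g q v ->
  mu * `|p - q| ^+ 2 <= '[u - v, p - q].
Proof.
move=> su sv; have := subdiff_strong su (subdiff_fin sv).
have := subdiff_strong sv (subdiff_fin su); rewrite !(sqr_norm_inner, innerE).
rewrite (innerC q p); lra.
Qed.

(** Makes the inverse of the subdifferential (1/mu)-Lipschitz, so that Cauchy subgradients have
    Cauchy base points. *)
Lemma subdiff_lipschitz p q u v : subdiff g p u -> subdiff g q v ->
  mu * `|p - q| <= `|u - v|.
Proof.
move=> su sv; have := le_trans (subdiff_strong_monotone su sv) (cauchy_schwarz _ _).
have [->|pq] := eqVneq p q; first by rewrite subrr normr0 !mulr0 normr_ge0.
by rewrite expr2 mulrA ler_pM2r// normr_gt0 subr_eq0.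
Qed.

End strongly_convex.
End subdifferential.

Lemma near_min {R : realType} {T : Type} (D : set T) (phi : T -> R) (b eta : R) :
  D !=set0 -> (forall w, D w -> b <= phi w) -> 0 < eta ->
  exists2 x, D x & forall w, D w -> phi x <= phi w + eta.
Proof.
move=> [w0 Dw0] lb eta0.
have hi : has_inf [set phi w | w in D].
  by split; [exists (phi w0), w0 | exists b => _ [w Dw <-]; exact: lb].
have [_ [x Dx <-] xlt] := inf_adherent eta0 hi.
exists x => // w Dw; apply: (le_trans (ltW xlt)); rewrite lerD2r.
by apply: ge_inf; [exact: hi.2 | exists w].
Qed.

(** * Surjectivity of the subdifferential, resolvents and Jensen's inequality *)

Section strongly_convex_theory.
Context {R : realType} {H : hilbertType R} (g : H -> \bar R) (mu : R).
Implicit Types (p q u v w z : H).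
Hypotheses (g_proper : proper_fun g) (g_lsc : lower_semicontinuous g).
Hypotheses (mu_gt0 : 0 < mu) (g_sc : strongly_convex mu g).
Hypothesis dom_subdiff : exists p u, subdiff g p u.

(** Quadratic growth of [g] around [p], with coefficient mu/2, outweighs the concave term - d |.|^2,
    so the perturbed function is bounded below. *)
Lemma tilted_near_min v (d eta : R) : 0 <= d -> d <= mu / 4 -> 0 < eta ->
  exists2 x, g x \is a fin_num & forall w, g w \is a fin_num ->
    fine (g x) - '[v, x] - d * `|x| ^+ 2
    <= fine (g w) - '[v, w] - d * `|w| ^+ 2 + eta.
Proof.
move=> d0 dmu eta0; have [p [u su]] := dom_subdiff.
(* [a] is the slope of the linear part in z = w - p; completing the square in mu/4 |z|^2 + <a, z>
   costs |a|^2 / mu. *)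
have [a aE] : exists a, a = u - v - (2 * d) *: p by eexists.
apply: (@near_min _ _ [set w | g w \is a fin_num] _
  (fine (g p) - '[v, p] - d * `|p| ^+ 2 - `|a| ^+ 2 / mu)) => //.
  exact: proper_dom.
move=> w; rewrite -[w](subrK p); move: (w - p) => z /= gw.
have := subdiff_strong g_proper g_sc su gw; rewrite addrK => sub.
have sq : 0 <= mu / 4 * `|z + (2 / mu) *: a| ^+ 2.
  by rewrite mulr_ge0 ?exprn_ge0// divr_ge0// ltW.
have sqE : mu / 4 * `|z + (2 / mu) *: a| ^+ 2
    = mu / 4 * `|z| ^+ 2 + '[a, z] + `|a| ^+ 2 / mu.
  rewrite sqr_normD innerZr !sqr_norm_inner !innerE (innerC z a); field.
  exact: lt0r_neq0.
have dz : (mu / 4 - d) * `|z| ^+ 2 >= 0.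
  by rewrite mulr_ge0 ?exprn_ge0 ?subr_ge0.
have aZ : '[a, z] = '[u, z] - '[v, z] - 2 * d * '[z, p].
  by rewrite aE !innerE (innerC z).
rewrite sqr_normD !innerDr; lra.
Qed.

(** Testing near minimality at [p] gives a quadratic inequality in |x - p|; the resulting radius is
    uniform in [d] and [eta]. *)
Lemma tilted_near_min_bound p u v x (d eta : R) : subdiff g p u ->
  0 <= d -> d <= mu / 4 -> d <= 1 -> eta <= 1 -> g x \is a fin_num ->
  (forall w, g w \is a fin_num ->
    fine (g x) - '[v, x] - d * `|x| ^+ 2
    <= fine (g w) - '[v, w] - d * `|w| ^+ 2 + eta) ->
  `|x - p| <= 1 + 4 * (1 + `|v - u| + 2 * `|p|) / mu.
Proof.
rewrite -[x](subrK p) addrK; move: (x - p) => {}z.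
move=> su d0 dmu d1 eta1 gx /(_ p (subdiff_fin g_proper su)) min.
have := subdiff_strong g_proper g_sc su gx; rewrite addrK => sub.
have dz : (mu / 4 - d) * `|z| ^+ 2 >= 0.
  by rewrite mulr_ge0 ?exprn_ge0 ?subr_ge0.
have cs := cauchy_schwarz (v - u) z.
have cs2 : d * '[p, z] <= `|p| * `|z|.
  apply: (@le_trans _ _ (d * (`|p| * `|z|))).
    by rewrite ler_wpM2l// cauchy_schwarz.
  by rewrite ler_piMl// mulr_ge0.
have key : mu / 4 * `|z| ^+ 2 <= 1 + (`|v - u| + 2 * `|p|) * `|z|.
  by move: min sub cs; rewrite sqr_normD !innerE (innerC z); lra.
(* The summand 1 of the radius covers |z| < 1; otherwise the constant 1 in [key] is at most |z|, and
   one factor |z| cancels. *)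
have [/ltW z1|z1] := ltP `|z| 1.
  by rewrite ler_wpDr// divr_ge0 ?(ltW mu_gt0)// mulr_ge0// !addr_ge0// mulr_ge0.
apply: ler_wpDl => //; rewrite ler_pdivlMr// mulrC -ler_pdivrMl//.
have z0 : 0 < `|z| by rewrite (lt_le_trans ltr01).
rewrite -(ler_pM2r z0); move: key; rewrite expr2; lra.
Qed.

(* Smooth variational principle: replacing the tilt [v_n] and the concave
   perturbation [- d_n |.|^2] by [v_n + d_n x_n] and [- d_(n+1) |.|^2], where
   [d_(n+1) = d_n / 2] and [x_n] is a near minimizer, adds the penalty
   [d_(n+1) |. - x_n|^2], which makes [x_n] a Cauchy sequence. *)
Lemma subdiff_range_dense v0 (eps : R) : 0 < eps ->
  exists p v, subdiff g p v /\ `|v - v0| <= eps.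
Proof.
move=> eps0; have [p0 [u0 su0]] := dom_subdiff.
(* The ball of radius [B] contains all near minimizers: the first by [tilted_near_min_bound], the
   others by a total drift of at most 4. *)
pose B := `|p0| + (1 + 4 * (1 + `|v0 - u0| + 2 * `|p0|) / mu) + 4.
have B0 : 0 < B.
  by rewrite ltr_wpDl// !addr_ge0// divr_ge0 ?ltW// mulr_gt0// ltr_wpDr// ltr_wpDr.
(* The bound eps / (4 B) keeps the total change of the tilts at most eps / 2. *)
pose delta := Num.min (Num.min 1 (mu / 4)) (eps / (4 * B)).
have delta0 : 0 < delta by rewrite !lt_min ltr01 !divr_gt0// mulr_gt0.
have delta1 : delta <= 1 by rewrite !ge_min lexx.
have deltamu : delta <= mu / 4 by rewrite !ge_min lexx orbT.
have deltaeps : delta * B <= eps / 4.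
  have := lexx delta; rewrite {2}/delta !le_min => /andP[_].
  by rewrite ler_pdivlMr ?mulr_gt0//; lra.
pose t n : R := 2^-1 ^+ n.
have t0 n : 0 < t n by rewrite exprn_gt0.
have t1 n : t n <= 1 by rewrite exprn_ile1 ?invr_ge0// invf_le1// ler1n.
(* The cube makes eta_n / d_n of order t_n^2, hence the increments of the near minimizers of order
   t_n. *)
pose d n := delta * t n; pose eta n := delta * t n ^+ 3.
have dlt n : 0 <= d n <= delta.
  by rewrite /d mulr_ge0 ?(ltW (t0 n)) ?(ltW delta0)//= ler_piMr// ltW.
have /choice[X XP] : forall vn : H * nat, exists x, g x \is a fin_num /\
    forall w, g w \is a fin_num ->
    fine (g x) - '[vn.1, x] - d vn.2 * `|x| ^+ 2
    <= fine (g w) - '[vn.1, w] - d vn.2 * `|w| ^+ 2 + eta vn.2.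
  move=> [v n]; have /andP[d0 dd] := dlt n.
  have [||x gx xmin] := @tilted_near_min v (d n) (eta n) d0.
  - exact: le_trans deltamu.
  - by rewrite mulr_gt0// exprn_gt0.
  - by exists x.
pose V := fix V n := if n is m.+1 then V m + d m *: X (V m, m) else v0.
pose x n := X (V n, n).
have gx n : g (x n) \is a fin_num := (XP (V n, n)).1.
have xmin n := (XP (V n, n)).2.
have tS n : t n.+1 = t n / 2 by rewrite /t exprS mulrC.
have dx n : `|x n.+1 - x n| <= 2 * 2^-1 ^+ n.
  rewrite -/(t n); have m1 := xmin n _ (gx n.+1).
  have := xmin n.+1 _ (gx n).
  rewrite /= -/(x n) -/(x n.+1) /d /eta !tS !innerE.
  move: m1; rewrite /= -/(x n) /d /eta => m1 m2.
  (* Adding the two near-minimality inequalities leaves d_(n+1) |x_(n+1) - x_n|^2 <= eta_n +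
     eta_(n+1). *)
  have sq : delta * (t n / 2) * `|x n.+1 - x n| ^+ 2
      <= delta * (t n / 2) * (9 / 4 * t n ^+ 2).
    rewrite sqr_normB (innerC (x n.+1)); move: m1 m2; rewrite -!sqr_norm_inner.
    lra.
  rewrite ler_pM2l ?mulr_gt0 ?divr_gt0// in sq.
  have : `|x n.+1 - x n| ^+ 2 <= (2 * t n) ^+ 2.
    by apply: (le_trans sq); rewrite exprMn; have := sqr_ge0 (t n); lra.
  by rewrite ler_pXn2r// nnegrE ?mulr_ge0// ltW.
have [xbd [p xp]] := geometric_cvg dx.
have xB n : `|x n| <= B.
  have := @tilted_near_min_bound p0 u0 v0 (x 0%N) (d 0%N) (eta 0%N) su0.
  have /andP[d00 d01] := dlt 0%N.
  have eta1 : eta 0%N <= 1 by rewrite /eta /t expr0 expr1n mulr1.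
  move=> /(_ d00 (le_trans d01 deltamu) (le_trans d01 delta1) eta1).
  move=> /(_ (gx 0%N) (xmin 0%N)) bd.
  have -> : x n = (x n - x 0%N) + ((x 0%N - p0) + p0) by rewrite !subrK.
  apply: (le_trans (ler_normD _ _)).
  have := ler_normD (x 0%N - p0) p0; have := xbd n; rewrite /B; lra.
have dV n : `|V n.+1 - V n| <= delta * B * 2^-1 ^+ n.
  rewrite /= addrAC subrr add0r normrZ ger0_norm; last by have /andP[] := dlt n.
  rewrite -/(t n) /d [leRHS]mulrAC ler_wpM2l//; last exact: xB.
  by rewrite mulr_ge0// ltW.
have [Vbd [v Vv]] := geometric_cvg dV.
have d_cvg : d @ \oo --> 0.
  rewrite -[0](mulr0 delta); apply: cvgMr; exact: cvg_half_pow.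
have eta_cvg : eta @ \oo --> 0.
  apply: (@squeeze_cvgr _ _ _ _ (fun=> 0) d) => //; last exact: cvg_cst.
  near=> n; rewrite /eta /d mulr_ge0 ?exprn_ge0 ?(ltW (t0 n)) ?(ltW delta0)//=.
  by rewrite ler_wpM2l ?(ltW delta0)// ler_iXnr ?(ltW (t0 n)) ?t1.
exists p, v; split.
  have sq_cvg (w : H) : d n * (`|w| ^+ 2 - `|x n| ^+ 2) @[n --> \oo] --> 0.
    rewrite -[0](mul0r (`|w| ^+ 2 - `|p| ^+ 2)); apply: cvgM => //.
    apply: cvgB; first exact: cvg_cst.
    rewrite sqr_norm_inner; under eq_fun do rewrite sqr_norm_inner.
    exact: cvg_inner.
  (* As d_n and eta_n tend to 0, near minimality turns into the subgradient inequality of [v] at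
     [p]. *)
  have lim w : g w \is a fin_num -> (g p <= (fine (g w) - '[v, w - p])%:E)%E.
    move=> gw; apply: (@lsc_lim _ _ g x (fun n => fine (g w) - '[V n, w - x n]
      - d n * (`|w| ^+ 2 - `|x n| ^+ 2) + eta n)) => //.
      rewrite -[X in _ --> X]addr0 -[X in _ --> X + _]subr0.
      apply: cvgD => //; apply: cvgB => //; apply: cvgB; first exact: cvg_cst.
      by apply: cvg_inner => //; apply: cvgB => //; exact: cvg_cst.
    move=> n; rewrite -(fineK (gx n)) lee_fin.
    by have := xmin n w gw; rewrite /= -/(x n) !innerE; lra.
  have gp : g p \is a fin_num by exact: proper_fin (lim _ (gx 0%N)).
  apply: subdiff_intro => // w /[dup] gw /lim.
  by rewrite -{1}(fineK gp) lee_fin lerBrDl.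
have [N _ /(_ N (leqnn N)) vN] : \forall n \near \oo, `|v - V n| <= eps / 2.
  by apply: cvgr_dist_le => //; rewrite divr_gt0.
have -> : v - v0 = (v - V N) + (V N - v0) by rewrite addrA subrK.
apply: (le_trans (ler_normD _ _)); have := Vbd N; rewrite /=; lra.
Unshelve. all: by end_near.
Qed.

(** Subgradients tending to [u] have Cauchy base points, and the graph of the subdifferential is
    closed. *)
Lemma subdiff_surjective u : exists p, subdiff g p u.
Proof.
have /choice[v /choice[p pv]] : forall n, exists v, exists p,
    subdiff g p v /\ `|v - u| <= 2^-1 ^+ n.
  move=> n; have [|p [v pv]] := @subdiff_range_dense u (2^-1 ^+ n).
    by rewrite exprn_gt0.
  by exists v, p.
have su n := (pv n).1; have vu n := (pv n).2.
have dv n : `|v n.+1 - v n| <= 2 * 2^-1 ^+ n.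
  have -> : v n.+1 - v n = (v n.+1 - u) - (v n - u) by rewrite opprB addrA subrK.
  apply: (le_trans (ler_normB _ _)); have := vu n.+1; have := vu n.
  have : 0 <= (2^-1 : R) ^+ n by rewrite exprn_ge0.
  rewrite exprS; lra.
have dp n : `|p n.+1 - p n| <= 2 / mu * 2^-1 ^+ n.
  rewrite mulrAC ler_pdivlMr// mulrC; apply: le_trans (dv n).
  exact: subdiff_lipschitz (su _) (su _).
have [_ [q pq]] := geometric_cvg dp.
exists q; apply: (subdiff_closed g_proper g_lsc pq _ su).
exact: cvg_dist_le cvg_half_pow vu.
Qed.

(* Banach's fixed point theorem for the gradient-like step
   [u |-> q u - s (T u - z)], where [T] is a selection of the inverse of the
   subdifferential; [T] is cocoercive with modulus [mu]. *)
Lemma subdiff_resolvent z (t : R) : 0 < t ->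
  exists p u, subdiff g p u /\ p + t *: u = z.
Proof.
move=> t0; have /choice[T sT] := subdiff_surjective.
(* These values give q = 1 - s t, so F u = u - s (T u + t u - z), and a fixed point of [F] solves
   the equation. *)
pose q := (1 + 2 * mu * t)^-1; pose s := 2 * mu * q.
have den0 : 0 < 1 + 2 * mu * t by rewrite addr_gt0// !mulr_gt0.
have q0 : 0 < q by rewrite invr_gt0.
have s0 : 0 < s by rewrite !mulr_gt0.
have qE : q = 1 - s * t by rewrite /s /q; field; exact: lt0r_neq0.
have q1 : q < 1 by rewrite qE ltrBlDr ltrDl mulr_gt0.
pose F u := q *: u - s *: T u + s *: z.
have lipF u v : `|F u - F v| <= q * `|u - v|.
  have mono := subdiff_strong_monotone g_proper g_sc (sT u) (sT v).
  have -> : F u - F v = q *: (u - v) - s *: (T u - T v).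
    rewrite /F opprD addrACA subrr addr0 !scalerBr !opprB addrACA.
    by rewrite [RHS]addrACA; congr (_ + _); exact: addrC.
  have : `|q *: (u - v) - s *: (T u - T v)| ^+ 2 <= (q * `|u - v|) ^+ 2.
    rewrite sqr_normB innerZl innerZr !normrZ !gtr0_norm// !exprMn.
    move: mono; move: ('[_, _]) (`|T u - T v| ^+ 2) (`|u - v| ^+ 2) => a b c ab.
    (* Since s = 2 mu q, the term s^2 |T u - T v|^2 is at most 2 q s <u - v, T u - T v>. *)
    have : 0 <= 2 * q * s * (a - mu * b) by rewrite !mulr_ge0 ?subr_ge0// ltW.
    rewrite /s; lra.
  by rewrite ler_pXn2r// nnegrE ?mulr_ge0// ltW.
pose f : {fun [set: H] >-> [set: H]} := @mkfun _ _ setT setT F (fun _ => id).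
have cf : is_contraction f.
  exists (NngNum (ltW q0)); split => //= -[u v] _; exact: lipF.
have [//|u _ uF] := banach_fixed_point cf closedT; first by exists 0.
exists (T u), u; split=> //; apply/eqP; rewrite -subr_eq0.
suff : s *: (T u + t *: u - z) = 0.
  by move/eqP; rewrite scaler_eq0 (gt_eqF s0).
have stE : s * t = 1 - q by rewrite qE opprB addrC subrK.
have <- : u - F u = 0 by rewrite [X in X - _]uF subrr.
rewrite scalerBr scalerDr scalerA stE scalerBl scale1r /F opprD opprB [RHS]addrA.
by congr (_ - _); exact: addrCA.
Qed.

(* With [p_n + t_n u_n = x] the average and [u_n] a subgradient at [p_n], the
   averaged subgradient inequalities give
   [sum_i w_i g(x_i) >= g(p_n) + |x - p_n|^2 / t_n], so that [p_n] tends to [x]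
   as [t_n] tends to [0]. *)
Lemma jensen (I : Type) (r : seq I) (c : I -> R) (x : I -> H) :
  (forall i, 0 <= c i) -> \sum_(i <- r) c i = 1 ->
  (forall i, g (x i) \is a fin_num) ->
  (g (\sum_(i <- r) c i *: x i)%R
    <= (\sum_(i <- r) c i * fine (g (x i)))%R%:E)%E.
Proof.
move=> c0 c1 gx; set L := \sum_(i <- r) _ * _.
have [xb xbE] : exists xb, xb = \sum_(i <- r) c i *: x i by eexists.
rewrite -xbE.
(* [m] minimizes [g]: it bounds g(p_n) below, hence <u_n, xb - p_n> above. *)
have [m sm] := subdiff_surjective 0.
have /choice[p /choice[u pu]] : forall n, exists p, exists u,
    subdiff g p u /\ p + (2^-1 ^+ n) ^+ 2 *: u = xb.
  by move=> n; apply: subdiff_resolvent; rewrite !exprn_gt0.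
have gp n := subdiff_fin g_proper (pu n).1.
have key n : fine (g (p n)) + '[u n, xb - p n] <= L.
  have -> : '[u n, xb - p n] = \sum_(i <- r) c i * '[u n, x i - p n].
    rewrite innerDr innerNr xbE inner_sumr -[X in _ - X]mul1r -c1 mulr_suml -sumrB.
    by apply: eq_bigr => i _; rewrite innerZr innerDr innerNr mulrDr mulrN.
  rewrite -[fine _]mul1r -c1 mulr_suml -big_split/=; apply: ler_sum => i _.
  rewrite -mulrDr ler_wpM2l// addrC.
  exact: subdiff_le (pu n).1 (gx i).
have E n : xb - p n = (2^-1 ^+ n) ^+ 2 *: u n.
  by rewrite -(pu n).2 addrAC subrr add0r.
have pun0 n : 0 <= '[u n, xb - p n].
  by rewrite E innerZr mulr_ge0 ?sqr_ge0// -sqr_norm_inner sqr_ge0.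
have le_m n : '[u n, xb - p n] <= L - fine (g m).
  have := key n; have := subdiff_le g_proper sm (gp n).
  by rewrite [X in X + _]inner0l; lra.
have Lm : 0 <= L - fine (g m) := le_trans (pun0 0%N) (le_m 0%N).
(* Uses |p_n - xb|^2 = 4^-n <u_n, xb - p_n> and L - g(m) <= (1 + L - g(m))^2. *)
have sq n : `|p n - xb| ^+ 2 <= ((1 + (L - fine (g m))) * 2^-1 ^+ n) ^+ 2.
  rewrite distrC sqr_norm_inner {1}E innerZl exprMn mulrC.
  rewrite ler_wpM2r ?sqr_ge0//; apply: (le_trans (le_m n)).
  have := sqr_ge0 (L - fine (g m)); lra.
have px : p @ \oo --> xb.
  apply: (@cvg_dist_le _ _ _ _ (fun n => (1 + (L - fine (g m))) * 2^-1 ^+ n)).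
    rewrite -[0](mulr0 (1 + (L - fine (g m)))).
    by apply: cvgMr; exact: cvg_half_pow.
  move=> n; have := sq n; have := addr_ge0 ler01 Lm => L0.
  by rewrite ler_pXn2r// nnegrE// mulr_ge0// exprn_ge0.
apply: (@lsc_lim _ _ g p (fun=> L)) => //; first exact: cvg_cst.
move=> n; rewrite -(fineK (gp n)) lee_fin; apply: le_trans (key n).
by rewrite lerDl.
Qed.

(** The resolvent supplies [q] with subgradient (z - q) / t; the prox inequality tested at [q] and
    strong convexity at [q] force p = q. *)
Lemma prox_subdiff (t : R) z p : 0 < t ->
  Prox (fun w => (t%:E * g w)%E) z p -> subdiff g p (t^-1 *: (z - p)).
Proof.
move=> t0 pz; have [q [u [su quz]]] := subdiff_resolvent z t0.
have gq := subdiff_fin g_proper su.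
have gp : g p \is a fin_num.
  have := pz q; rewrite -(fineK gq).
  have [//|/(proper_not_fin g_proper)->] := boolP (g p \is a fin_num).
  by rewrite gt0_muley ?lte_fin.
have := pz q; rewrite -(fineK gq) -(fineK gp) -!EFinM -!EFinD lee_fin.
have sub := ler_wpM2l (ltW t0) (subdiff_strong g_proper g_sc su gp).
rewrite -quz.
have -> : q + t *: u - p = t *: u - (p - q) by rewrite opprB [RHS]addrA (addrC q).
rewrite [q + _]addrC addrK (sqr_normB _ (p - q)) innerZl => prox.
have : `|p - q| ^+ 2 <= 0.
  have : 0 <= t * mu * `|p - q| ^+ 2 by rewrite !mulr_ge0 ?exprn_ge0// ltW.
  lra.
rewrite exprn_even_le0//= normr_eq0 subr_eq0 => /eqP pq.
rewrite pq subrr subr0 scalerA mulVf ?scale1r//.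
exact: lt0r_neq0.
Qed.

End strongly_convex_theory.

(** * The one-step inequality *)

(** The squares of the two sides differ by (A/2 a^2 - C/2 b^2)^2. *)
Lemma amgm {R : realType} (A C k a b : R) : 0 <= A -> 0 <= C -> A * C = k ^+ 2 ->
  0 <= k -> 0 <= a -> 0 <= b -> k * (a * b) <= A / 2 * a ^+ 2 + C / 2 * b ^+ 2.
Proof.
move=> A0 C0 ACk k0 a0 b0.
have le_sq : (k * (a * b)) ^+ 2 <= (A / 2 * a ^+ 2 + C / 2 * b ^+ 2) ^+ 2.
  have -> : (k * (a * b)) ^+ 2 = A * C * (a ^+ 2 * b ^+ 2).
    by rewrite ACk !exprMn.
  rewrite -subr_ge0; have := sqr_ge0 (A / 2 * a ^+ 2 - C / 2 * b ^+ 2); lra.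
by move: le_sq; rewrite ler_pXn2r// nnegrE !(mulr_ge0, addr_ge0, exprn_ge0).
Qed.

(** * Young's inequality for the bilinear form of a bounded operator *)

Section operator.
Context {R : realType} {H1 H2 : hilbertType R} (K : {linear H1 -> H2}).

Hypothesis K_cont : continuous K.

Lemma opnorm_ub x : `|x| <= 1 -> `|K x| <= opnorm K.
Proof.
have /linear_bounded_continuous/linear_boundedP/pinfty_ex_gt0[r r0 Kr] := K_cont.
move=> x1; apply: ub_le_sup; last by exists x.
exists r => _ [z z1 <-]; apply: (le_trans (Kr z)).
by rewrite ler_piMr// ltW.
Qed.

Lemma opnorm_ge0 : 0 <= opnorm K.
Proof. by rewrite -(@normr0 _ H2) -(linear0 K) opnorm_ub// normr0. Qed.

Lemma le_opnorm x : `|K x| <= opnorm K * `|x|.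
Proof.
have [->|x0] := eqVneq x 0; first by rewrite linear0 !normr0 mulr0.
rewrite -ler_pdivrMr ?normr_gt0//.
have -> : `|K x| / `|x| = `|K (`|x|^-1 *: x)|.
  by rewrite linearZ normrZ normfV normr_id mulrC.
by rewrite opnorm_ub// normrZ normfV normr_id mulVf ?normr_eq0.
Qed.

Lemma inner_le_opnorm (u : H1) (v : H2) :
  '[K u, v] <= opnorm K * (`|u| * `|v|).
Proof.
apply: (le_trans (cauchy_schwarz _ _)).
by rewrite mulrA ler_wpM2r// le_opnorm.
Qed.

(** The constraint A C = ||K||^2 covers both ways, (a) and (b), of distributing the operator norm
    over the Young weights. *)
Lemma inner_young (A C s : R) (u : H1) (v : H2) :
  0 <= A -> 0 <= C -> A * C = opnorm K ^+ 2 ->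
  s * '[K u, v] <= A / 2 * s ^+ 2 * `|u| ^+ 2 + C / 2 * `|v| ^+ 2.
Proof.
move=> A0 C0 AC; rewrite -innerZl -linearZ.
apply: (le_trans (inner_le_opnorm _ _)).
rewrite -mulrA -(real_normK (num_real s)) -exprMn -normrZ.
by apply: amgm => //; exact: opnorm_ge0.
Qed.

Lemma inner_young_r (A C s : R) (u : H1) (v : H2) :
  0 <= A -> 0 <= C -> A * C = opnorm K ^+ 2 ->
  s * '[K u, v] <= A / 2 * s ^+ 2 * `|v| ^+ 2 + C / 2 * `|u| ^+ 2.
Proof.
move=> A0 C0 AC; rewrite -innerZr.
apply: (le_trans (inner_le_opnorm _ _)).
rewrite [`|u| * _]mulrC -mulrA -(real_normK (num_real s)) -exprMn -normrZ.
by apply: amgm => //; exact: opnorm_ge0.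
Qed.

End operator.

Section one_step.
Context {R : realType} {H1 H2 : hilbertType R}.
Variables (K : {linear H1 -> H2}) (Ks : H2 -> H1).
Hypotheses (K_cont : continuous K) (K_adj : is_adjoint K Ks).
Variables (A1 A2 A3 C1 C2 C3 : R).
Hypotheses (A1_ge0 : 0 <= A1) (A2_ge0 : 0 <= A2) (A3_ge0 : 0 <= A3).
Hypotheses (C1_ge0 : 0 <= C1) (C2_ge0 : 0 <= C2) (C3_ge0 : 0 <= C3).
Hypotheses (AC1 : A1 * C1 = opnorm K ^+ 2) (AC2 : A2 * C2 = opnorm K ^+ 2)
  (AC3 : A3 * C3 = opnorm K ^+ 2).

(* [p = x - x'], [q = y - y'], [dx = x' - xk], [dy = y' - yk], where [(x', y')]
   is the iterate following [(xk, yk)], and [d] is the previous [dx]. *)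
Lemma one_step (x' p dx d : H1) (y' q dy : H2)
    (tau sigma a b xi mu nu itl isl ith gx gx' hy hy' : R) :
  0 < tau -> 0 < sigma ->
  itl + A3 * b ^+ 2 <= mu + tau^-1 ->
  isl + A2 * (xi - a) ^+ 2 <= nu + sigma^-1 ->
  A1 * xi ^+ 2 + C2 <= xi * ith ->
  C1 + C3 <= sigma^-1 ->
  ith <= tau^-1 ->
  '[tau^-1 *: (- (tau *: Ks (y' + b *: dy)) - dx), p]
    + mu / 2 * `|p| ^+ 2 + gx' <= gx ->
  '[sigma^-1 *: (sigma *: K (x' - dx + a *: d) - dy), q]
    + nu / 2 * `|q| ^+ 2 + hy' <= hy ->
  ('[K x', y' + q] + gx' - hy) - ('[K (x' + p), y'] + gx - hy')
    + (itl / 2 * `|p| ^+ 2 + isl / 2 * `|q| ^+ 2 + ith / 2 * `|dx| ^+ 2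
       - '[K dx, q])
  <= tau^-1 / 2 * `|p + dx| ^+ 2 + sigma^-1 / 2 * `|q + dy| ^+ 2
     + xi * (ith / 2 * `|d| ^+ 2 - '[K d, q + dy]).
Proof.
move=> tau0 sigma0 c1 c2 c3 c4 c5.
have adj v : '[Ks v, p] = '[K p, v] by rewrite innerC -K_adj.
have tauK r : tau^-1 * - (tau * r) = - r by rewrite mulrN mulKf// gt_eqF.
have sigmaK r : sigma^-1 * (sigma * r) = r by rewrite mulKf// gt_eqF.
rewrite !linearD (linearN K) (linearZ_LR K) /=.
rewrite !(innerE, adj, tauK, sigmaK) !sqr_normD.
(* After cancellation three products remain, with factors b, xi - a and xi; each is split with its
   own pair (A_i, C_i). *)
have := inner_young K_cont b p dy A3_ge0 C3_ge0 AC3.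
have := inner_young_r K_cont (xi - a) d q A2_ge0 C2_ge0 AC2.
have := inner_young K_cont xi d dy A1_ge0 C1_ge0 AC1.
have scale (V : hilbertType R) (r s : R) (v : V) :
    r <= s -> r * `|v| ^+ 2 <= s * `|v| ^+ 2.
  by move=> rs; rewrite ler_wpM2r ?sqr_ge0.
have := scale _ _ _ p c1; have := scale _ _ _ q c2; have := scale _ _ _ d c3.
have := scale _ _ _ dy c4; have := scale _ _ _ dx c5.
rewrite (innerC dx p) (innerC dy q); lra.
Qed.

End one_step.

(** The energy left by step n pays for the budget of step n + 1: xi^-(n+1) B_(n+1) <= xi^-n E_n. *)
Lemma weighted_telescope {R : realType} (xi D : R) (G E B : nat -> R) : 0 < xi ->
  (forall n, G n + E n <= B n) -> B 0%N <= D -> (forall n, B n.+1 <= xi * E n) ->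
  forall n, \sum_(0 <= i < n.+1) xi ^- i * G i + xi ^- n * E n <= D.
Proof.
move=> xi0 GEB B0 BE; elim=> [|n IH].
  by rewrite big_nat1 expr0 invr1 !mul1r (le_trans (GEB 0%N)).
rewrite big_nat_recr//= -addrA -mulrDr; apply: le_trans IH; rewrite lerD2l.
apply: (@le_trans _ _ (xi ^- n.+1 * (xi * E n))).
  apply: ler_wpM2l; first by rewrite invr_ge0 exprn_ge0// ltW.
  exact: le_trans (GEB _) (BE _).
by rewrite exprSr invfM -mulrA mulKf// gt_eqF.
Qed.

(** * Ergodic averages *)

Section ergodic_average.
Context {R : realType} {H : hilbertType R} (xi : R).
Hypothesis xi_gt0 : 0 < xi.

Definition ergodic_mass n : R := \sum_(0 <= j < n.+1) xi ^- j.

Lemma ergodic_mass_ge n : xi ^- n <= ergodic_mass n.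
Proof.
rewrite /ergodic_mass big_nat_recr//= lerDr sumr_ge0// => i _.
by rewrite invr_ge0 exprn_ge0// ltW.
Qed.

Lemma ergodic_mass_gt0 n : 0 < ergodic_mass n.
Proof. by apply: lt_le_trans (ergodic_mass_ge n); rewrite invr_gt0 exprn_gt0. Qed.

Lemma ergodic_mass_inv n : (ergodic_mass n)^-1 <= xi ^+ n.
Proof.
rewrite -[leRHS]invrK lef_pV2 ?posrE ?ergodic_mass_ge//.
  exact: ergodic_mass_gt0.
by rewrite invr_gt0 exprn_gt0.
Qed.

Definition ergodic_weight n i : R := (ergodic_mass n)^-1 * xi ^- i.

Lemma ergodic_weight_ge0 n i : 0 <= ergodic_weight n i.
Proof.
by rewrite mulr_ge0 ?invr_ge0 ?exprn_ge0 ?(ltW (ergodic_mass_gt0 n)) ?ltW.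
Qed.

Lemma sum_ergodic_weight n : \sum_(0 <= i < n.+1) ergodic_weight n i = 1.
Proof. by rewrite -mulr_sumr mulVf// gt_eqF// ergodic_mass_gt0. Qed.

Lemma ergodicE (x : nat -> H) n :
  ergodic xi x n = \sum_(0 <= i < n.+1) ergodic_weight n i *: x i.+1.
Proof.
by rewrite /ergodic scaler_sumr; apply: eq_bigr => i _; rewrite scalerA.
Qed.

Lemma ergodic_dist (x : nat -> H) (z : H) (B : R) n :
  (forall i, `|x i.+1 - z| <= B) -> `|ergodic xi x n - z| <= B.
Proof.
move=> xB; rewrite ergodicE -[z]scale1r -(sum_ergodic_weight n) scaler_suml.
rewrite -sumrB; apply: (le_trans (ler_norm_sum _ _ _)).
rewrite -[leRHS]mul1r -(sum_ergodic_weight n) mulr_suml; apply: ler_sum => i _.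
have c0 := ergodic_weight_ge0 n i.
by rewrite -scalerBr normrZ ger0_norm// ler_wpM2l.
Qed.

End ergodic_average.

(** * Finite bounds drawn from extended-real suprema and infima *)

Section extended_bounds.
Context {R : realType}.
Implicit Types (u : nat -> R).

Lemma le_supE u k : ((u k)%:E <= supE u)%E.
Proof. by apply: ereal_sup_ubound; exists k. Qed.

Lemma supE_fin u (r : R) : (supE u <= r%:E)%E ->
  exists s, [/\ supE u = s%:E, s <= r & forall k, u k <= s].
Proof.
move=> ur; have uk := le_supE u; case: (supE u) ur uk => [s| |].
- by rewrite lee_fin => sr us; exists s; split=> // k; rewrite -lee_fin us.
- by rewrite leye_eq.
- by move=> _ /(_ 0%N); rewrite leeNy_eq.
Qed.

Lemma infE_fin u : (0 < infE u)%E ->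
  exists s, [/\ infE u = s%:E, 0 < s & forall k, s <= u k].
Proof.
have uk k : (infE u <= (u k)%:E)%E by apply: ereal_inf_lbound; exists k.
case: (infE u) uk => [s| |] //.
- by move=> uk s0; exists s; split=> // k; rewrite -lee_fin uk.
- by move=> /(_ 0%N); rewrite leye_eq.
Qed.

Lemma step_condition (xi tl th c mu : R) u : 0 < xi -> 0 < tl -> 0 < th -> 0 <= c ->
  (1 / (xi%:E * tl%:E) - 1 / th%:E + c%:E * supE u <= mu%:E)%E ->
  forall k, (xi * tl)^-1 - th^-1 + c * u k <= mu.
Proof.
move=> xi0 tl0 th0 c0 le_mu k.
have xitl : 0 < xi * tl by rewrite mulr_gt0.
rewrite -lee_fin; apply: le_trans le_mu.
rewrite -EFinM !div1e !inver !gt_eqF// EFinD EFinB EFinM leeD2l//.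
by rewrite lee_wpmul2l// le_supE.
Qed.

End extended_bounds.

(* Only meaningful where [g u] and [h v] are finite, since [fine] maps infinite
   values to [0]. *)
Definition real_lagrangian {R : realType} {H1 H2 : hilbertType R} (K : H1 -> H2)
    (g : H1 -> \bar R) (h : H2 -> \bar R) (u : H1) (v : H2) : R :=
  '[K u, v] + fine (g u) - fine (h v).

Lemma lagrangian_fin {R : realType} {H1 H2 : hilbertType R} (K : H1 -> H2)
    (g : H1 -> \bar R) (h : H2 -> \bar R) u v :
  g u \is a fin_num -> h v \is a fin_num ->
  lagrangian K g h u v = (real_lagrangian K g h u v)%:E.
Proof. by move=> gu hv; rewrite /lagrangian -(fineK gu) -(fineK hv). Qed.

(** * Finiteness and optimality conditions at a saddle point *)

Section saddle_point.
Context {R : realType} {H1 H2 : hilbertType R}.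
Variables (K : {linear H1 -> H2}) (Ks : H2 -> H1) (K_adj : is_adjoint K Ks).
Variables (g : H1 -> \bar R) (h : H2 -> \bar R) (xs : H1) (ys : H2).
Hypotheses (g_proper : proper_fun g) (h_proper : proper_fun h).
Hypothesis saddle : saddle_point (lagrangian K g h) xs ys.

(** Compare with a point where [g] and [h] are finite; with both values infinite, +oo would have to
    lie below +oo - +oo = -oo. *)
Lemma saddle_fin : g xs \is a fin_num /\ h ys \is a fin_num.
Proof.
have [u gu] := proper_dom g_proper; have [v hv] := proper_dom h_proper.
have [+ _] := saddle u v; have [_ +] := saddle u v; rewrite /lagrangian.
have := g_proper.1 xs; have := h_proper.1 ys.
rewrite -(fineK gu) -(fineK hv).
by case: (g xs) => [?| |] //; case: (h ys) => [?| |].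
Qed.

Lemma saddle_le u v : g u \is a fin_num -> h v \is a fin_num ->
  real_lagrangian K g h xs v <= real_lagrangian K g h xs ys
  <= real_lagrangian K g h u ys.
Proof.
move=> gu hv; have [gs hs] := saddle_fin; have [] := saddle u v.
by rewrite !lagrangian_fin// !lee_fin => -> ->.
Qed.

(** [xs] minimizes <K x, ys> + g(x). This also shows that the subdifferential has nonempty domain,
    on which the convexity theory rests. *)
Lemma saddle_subdiff_x : subdiff g xs (- Ks ys).
Proof.
have [gs hs] := saddle_fin; apply: subdiff_intro => // w gw.
have /andP[_] := saddle_le gw hs; rewrite /real_lagrangian !innerE.
rewrite !(innerC (Ks ys)) -!K_adj; lra.
Qed.

Lemma saddle_subdiff_y : subdiff h ys (K xs).
Proof.
have [gs hs] := saddle_fin; apply: subdiff_intro => // w hw.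
have /andP[+ _] := saddle_le gs hw; rewrite /real_lagrangian !innerE; lra.
Qed.

End saddle_point.

(** * Weighted gap along the iterates, ergodic gap and boundedness *)

Section ergodic_gap.
Context {R : realType} {H1 H2 : hilbertType R}.
Variables (K : {linear H1 -> H2}) (Ks : H2 -> H1).
Hypotheses (K_cont : continuous K) (K_adj : is_adjoint K Ks).
Variables (g : H1 -> \bar R) (h : H2 -> \bar R) (mu nu : R).
Hypotheses (g_proper : proper_fun g) (g_lsc : lower_semicontinuous g).
Hypotheses (h_proper : proper_fun h) (h_lsc : lower_semicontinuous h).
Hypotheses (mu_gt0 : 0 < mu) (nu_gt0 : 0 < nu).
Hypotheses (g_sc : strongly_convex mu g) (h_sc : strongly_convex nu h).
Hypothesis dom_g : exists p u, subdiff g p u.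
Hypothesis dom_h : exists p u, subdiff h p u.
Variables (tau sigma alpha beta : nat -> R).
Hypotheses (tau_gt0 : forall k, 0 < tau k) (sigma_gt0 : forall k, 0 < sigma k).
Variables (x xbar : nat -> H1) (y ybar : nat -> H2).
Hypothesis xy_gen :
  alternating_proximal K Ks g h tau sigma alpha beta x xbar y ybar.
Variables (xi A1 A2 A3 C1 C2 C3 tl th sl sh : R).
Hypotheses (xi_gt0 : 0 < xi) (xi_lt1 : xi < 1).
Hypotheses (A1_ge0 : 0 <= A1) (A2_ge0 : 0 <= A2) (A3_ge0 : 0 <= A3).
Hypotheses (C1_ge0 : 0 <= C1) (C2_ge0 : 0 <= C2) (C3_ge0 : 0 <= C3).
Hypotheses (AC1 : A1 * C1 = opnorm K ^+ 2) (AC2 : A2 * C2 = opnorm K ^+ 2)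
  (AC3 : A3 * C3 = opnorm K ^+ 2).
Hypotheses (tl_gt0 : 0 < tl) (sl_gt0 : 0 < sl).
Hypotheses (tauP : forall k, tl <= tau k <= th)
  (sigmaP : forall k, sl <= sigma k <= sh).
Hypothesis step : xi * sh * (th * opnorm K ^+ 2) < 1.
Hypothesis cond_mu : forall k, (xi * tl)^-1 - th^-1 + A3 * beta k ^+ 2 <= mu.
Hypothesis cond_nu :
  forall k, (xi * sl)^-1 - sh^-1 + A2 * (xi - alpha k) ^+ 2 <= nu.
Hypothesis cond_x : A1 * xi ^+ 2 + C2 <= xi / th.
Hypothesis cond_y : C1 + C3 <= sh^-1.

Local Notation F := (real_lagrangian K g h).
Definition initial_gap u v : R := (tau 0%N)^-1 / 2 * `|u - x 0%N| ^+ 2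
  + (sigma 0%N)^-1 / 2 * `|v - y 0%N| ^+ 2.

Let th_gt0 : 0 < th.
Proof. by have /andP[/(lt_le_trans tl_gt0)] := tauP 0%N; exact: lt_le_trans. Qed.

Let sh_gt0 : 0 < sh.
Proof. by have /andP[/(lt_le_trans sl_gt0)] := sigmaP 0%N; exact: lt_le_trans. Qed.

Lemma apm_subdiff_x k : subdiff g (x k.+1)
  ((tau k)^-1 *: (- (tau k *: Ks (ybar k.+1)) + x k - x k.+1)).
Proof.
by apply: (prox_subdiff g_proper g_lsc mu_gt0) => //; exact: apm_x xy_gen k.
Qed.

Lemma apm_subdiff_y k : subdiff h (y k.+1)
  ((sigma k)^-1 *: (sigma k *: K (xbar k) + y k - y k.+1)).
Proof.
by apply: (prox_subdiff h_proper h_lsc nu_gt0) => //; exact: apm_y xy_gen k.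
Qed.

Lemma apm_fin_x k : g (x k.+1) \is a fin_num.
Proof. exact: subdiff_fin (apm_subdiff_x k). Qed.

Lemma apm_fin_y k : h (y k.+1) \is a fin_num.
Proof. exact: subdiff_fin (apm_subdiff_y k). Qed.

(** [dprev 0 = 0] encodes x^{-1} = x^0; taking [aprev 0 = alpha 0] lets [cond_nu] apply at step 0
    too. *)
Let dprev n := if n is m.+1 then x m.+1 - x m else 0.
Let aprev n := if n is m.+1 then alpha m else alpha 0%N.

Let xbarE n : xbar n = x n + aprev n *: dprev n.
Proof.
case: n => [|n]; first by rewrite (apm_xbar0 xy_gen) scaler0 addr0.
exact: apm_xbar xy_gen n.
Qed.

(** What step n leaves over; the uniform bounds [tl], [sl], [th] stand in for the step sizes so that
    xi times the energy covers the next budget. *)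
Let energy u v n : R :=
  (xi * tl)^-1 / 2 * `|u - x n.+1| ^+ 2 + (xi * sl)^-1 / 2 * `|v - y n.+1| ^+ 2
  + th^-1 / 2 * `|x n.+1 - x n| ^+ 2 - '[K (x n.+1 - x n), v - y n.+1].

Let budget u v n : R :=
  (tau n)^-1 / 2 * `|u - x n| ^+ 2 + (sigma n)^-1 / 2 * `|v - y n| ^+ 2
  + xi * (th^-1 / 2 * `|dprev n| ^+ 2 - '[K (dprev n), v - y n]).

Let gap_step u v n : g u \is a fin_num -> h v \is a fin_num ->
  F (x n.+1) v - F u (y n.+1) + energy u v n <= budget u v n.
Proof.
move=> gu hv.
have /andP[tln thn] := tauP n; have /andP[sln shn] := sigmaP n.
have ith : th^-1 <= (tau n)^-1 by rewrite lef_pV2 ?posrE.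
have ish : sh^-1 <= (sigma n)^-1 by rewrite lef_pV2 ?posrE.
have condx : (xi * tl)^-1 + A3 * beta n ^+ 2 <= mu + (tau n)^-1.
  by have := cond_mu n; lra.
have condy : (xi * sl)^-1 + A2 * (xi - aprev n) ^+ 2 <= nu + (sigma n)^-1.
  have : (xi * sl)^-1 - sh^-1 + A2 * (xi - aprev n) ^+ 2 <= nu.
    by rewrite /aprev; case: (n).
  lra.
have hx := subdiff_strong g_proper g_sc (apm_subdiff_x n) gu.
have hy := subdiff_strong h_proper h_sc (apm_subdiff_y n) hv.
have dE (V : zmodType) (a b c : V) : a + b - c = a - (c - b).
  by rewrite opprB addrA.
have xE : x n = x n.+1 - (x n.+1 - x n) by rewrite subKr.
rewrite (apm_ybar xy_gen n) (dE _ _ (x n)) in hx.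
rewrite xbarE [X in K (X + _)]xE (dE _ _ (y n)) in hy.
have := one_step K_cont K_adj A1_ge0 A2_ge0 A3_ge0 C1_ge0 C2_ge0 C3_ge0 AC1 AC2 AC3
  (tau_gt0 n) (sigma_gt0 n) condx condy cond_x (le_trans cond_y ish) ith hx hy.
rewrite [y n.+1 + _]addrC [x n.+1 + _]addrC !subrK /real_lagrangian /energy /budget.
rewrite !addrA !subrK; lra.
Qed.

Let weighted_gap u v n : g u \is a fin_num -> h v \is a fin_num ->
  \sum_(0 <= i < n.+1) xi ^- i * (F (x i.+1) v - F u (y i.+1))
    + xi ^- n * energy u v n <= initial_gap u v.
Proof.
move=> gu hv; apply: (weighted_telescope xi_gt0 (B := budget u v)).
- by move=> k; exact: gap_step.
- by rewrite /budget /= linear0 inner0l normr0 expr0n/= !mulr0 subrr mulr0 addr0.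
- move=> k; rewrite /budget /energy /=.
  have /andP[tln _] := tauP k.+1; have /andP[sln _] := sigmaP k.+1.
  have itl : (tau k.+1)^-1 <= xi * (xi * tl)^-1.
    by rewrite invfM mulVKf ?gt_eqF// lef_pV2 ?posrE.
  have isl : (sigma k.+1)^-1 <= xi * (xi * sl)^-1.
    by rewrite invfM mulVKf ?gt_eqF// lef_pV2 ?posrE.
  have := ler_wpM2r (sqr_ge0 `|u - x k.+1|) itl.
  have := ler_wpM2r (sqr_ge0 `|v - y k.+1|) isl.
  lra.
Qed.

(** The coefficient of |v - y_(n+1)|^2 left once Young's inequality, with weights 1/th and th
    ||K||^2, has absorbed the cross term; positive by the step-size condition. *)
Let kappa : R := ((xi * sl)^-1 - th * opnorm K ^+ 2) / 2.

Let kappa_gt0 : 0 < kappa.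
Proof.
have /andP[sln /(le_trans sln) slsh] := sigmaP 0%N.
rewrite divr_gt0// subr_gt0 -[ltRHS]mul1r ltr_pdivlMr ?mulr_gt0//.
apply: le_lt_trans step; rewrite [leRHS]mulrC ler_wpM2l//.
  by rewrite mulr_ge0 ?sqr_ge0// ltW.
by rewrite ler_wpM2l// ltW.
Qed.

Let energy_ge u v n : (xi * tl)^-1 / 2 * `|u - x n.+1| ^+ 2
  + kappa * `|v - y n.+1| ^+ 2 <= energy u v n.
Proof.
have thV : th^-1 * (th * opnorm K ^+ 2) = opnorm K ^+ 2 by rewrite mulKf// gt_eqF.
have thV0 : 0 <= th^-1 by rewrite invr_ge0 ltW.
have thK0 : 0 <= th * opnorm K ^+ 2 by rewrite mulr_ge0 ?sqr_ge0// ltW.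
have := inner_young K_cont 1 (x n.+1 - x n) (v - y n.+1) thV0 thK0 thV.
rewrite /energy /kappa; lra.
Qed.

Let energy_ge0 u v n : 0 <= energy u v n.
Proof.
apply: le_trans (energy_ge u v n); rewrite addr_ge0// mulr_ge0 ?sqr_ge0//.
  by rewrite divr_ge0// invr_ge0 mulr_ge0// ltW.
exact: ltW.
Qed.

Lemma ergodic_fin_x n : g (ergodic xi x n) \is a fin_num.
Proof.
rewrite ergodicE; apply: proper_fin => //.
apply: (jensen g_proper g_lsc mu_gt0 g_sc dom_g) => [i||i].
- exact: ergodic_weight_ge0.
- exact: sum_ergodic_weight.
- exact: apm_fin_x.
Qed.

Lemma ergodic_fin_y n : h (ergodic xi y n) \is a fin_num.
Proof.
rewrite ergodicE; apply: proper_fin => //.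
apply: (jensen h_proper h_lsc nu_gt0 h_sc dom_h) => [i||i].
- exact: ergodic_weight_ge0.
- exact: sum_ergodic_weight.
- exact: apm_fin_y.
Qed.

(** Jensen handles [g] and [h], linearity the bilinear terms, and the nonnegative energy is dropped.
    The comparison point is left free because [u] or [v] will itself be an average. *)
Lemma ergodic_gap u v n : g u \is a fin_num -> h v \is a fin_num ->
  F (ergodic xi x n) v - F u (ergodic xi y n) <= xi ^+ n * initial_gap u v.
Proof.
move=> gu hv; pose c := ergodic_weight xi n.
have c0 i : 0 <= c i by exact: ergodic_weight_ge0.
have c1 : \sum_(0 <= i < n.+1) c i = 1 by exact: sum_ergodic_weight.
have jx : fine (g (ergodic xi x n)) <= \sum_(0 <= i < n.+1) c i * fine (g (x i.+1)).
  rewrite -lee_fin fineK ?ergodic_fin_x// ergodicE.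
  by apply: (jensen g_proper g_lsc mu_gt0 g_sc dom_g) => // i; exact: apm_fin_x.
have jy : fine (h (ergodic xi y n)) <= \sum_(0 <= i < n.+1) c i * fine (h (y i.+1)).
  rewrite -lee_fin fineK ?ergodic_fin_y// ergodicE.
  by apply: (jensen h_proper h_lsc nu_gt0 h_sc dom_h) => // i; exact: apm_fin_y.
have kx : '[K (ergodic xi x n), v] = \sum_(0 <= i < n.+1) c i * '[K (x i.+1), v].
  rewrite ergodicE linear_sum innerC inner_sumr; apply: eq_bigr => i _.
  by rewrite linearZ innerZr innerC.
have ky : '[K u, ergodic xi y n] = \sum_(0 <= i < n.+1) c i * '[K u, y i.+1].
  by rewrite ergodicE inner_sumr; apply: eq_bigr => i _; rewrite innerZr.
have cst r : r = \sum_(0 <= i < n.+1) c i * r by rewrite -mulr_suml c1 mul1r.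
have sumE : \sum_(0 <= i < n.+1) c i * (F (x i.+1) v - F u (y i.+1))
    = '[K (ergodic xi x n), v] + \sum_(0 <= i < n.+1) c i * fine (g (x i.+1))
      - fine (h v) - ('[K u, ergodic xi y n] + fine (g u)
      - \sum_(0 <= i < n.+1) c i * fine (h (y i.+1))).
  transitivity (\sum_(0 <= i < n.+1)
    (c i * '[K (x i.+1), v] + c i * fine (g (x i.+1)) - c i * fine (h v)
     - (c i * '[K u, y i.+1] + c i * fine (g u) - c i * fine (h (y i.+1))))).
    by apply: eq_bigr => i _; rewrite /real_lagrangian; ring.
  by rewrite !(sumrB, big_split)/= -kx -ky -(cst (fine (h v))) -(cst (fine (g u))).
apply: (@le_trans _ _ ((ergodic_mass xi n)^-1 * initial_gap u v)).
  apply: (@le_trans _ _ (\sum_(0 <= i < n.+1) c i * (F (x i.+1) v - F u (y i.+1)))).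
    by rewrite sumE /real_lagrangian; lra.
  under eq_bigr do rewrite -mulrA.
  rewrite -mulr_sumr ler_wpM2l ?invr_ge0 ?(ltW (ergodic_mass_gt0 xi_gt0 n))//.
  have := weighted_gap n gu hv.
  have : 0 <= xi ^- n * energy u v n.
    by rewrite mulr_ge0 ?energy_ge0// invr_ge0 exprn_ge0// ltW.
  lra.
apply: ler_wpM2r; last exact: ergodic_mass_inv.
by rewrite addr_ge0// mulr_ge0 ?sqr_ge0// divr_ge0// invr_ge0 ltW.
Qed.

(** With nonnegative gaps and xi^-k >= 1, the energy itself never exceeds the initial gap, and it
    controls both distances. *)
Lemma apm_bounded u v : g u \is a fin_num -> h v \is a fin_num ->
  (forall k, 0 <= F (x k.+1) v - F u (y k.+1)) ->
  exists B, forall k, `|x k.+1 - u| <= B /\ `|y k.+1 - v| <= B.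
Proof.
move=> gu hv gap0.
have bnd k : energy u v k <= initial_gap u v.
  have := weighted_gap k gu hv.
  have : 0 <= \sum_(0 <= i < k.+1) xi ^- i * (F (x i.+1) v - F u (y i.+1)).
    by apply: sumr_ge0 => i _; rewrite mulr_ge0// invr_ge0 exprn_ge0// ltW.
  have : energy u v k <= xi ^- k * energy u v k.
    by rewrite ler_peMl ?energy_ge0// invf_ge1 ?exprn_gt0// exprn_ile1// ltW.
  lra.
(* The bound a <= 1 + a^2 replaces a square root. *)
have le_sqrt (a c r : R) : 0 < c -> c * a ^+ 2 <= r -> a <= 1 + r / c.
  move=> c0; rewrite mulrC -ler_pdivlMr// => ar.
  by apply: le_trans (lerD (lexx 1) ar); have := sqr_ge0 (a - 1 / 2); lra.
have itl0 : 0 < (xi * tl)^-1 / 2 by rewrite divr_gt0// invr_gt0 mulr_gt0.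
exists (Num.max (1 + initial_gap u v / ((xi * tl)^-1 / 2))
  (1 + initial_gap u v / kappa)).
move=> k; have := le_trans (energy_ge u v k) (bnd k).
have := mulr_ge0 (ltW itl0) (sqr_ge0 `|u - x k.+1|).
have := mulr_ge0 (ltW kappa_gt0) (sqr_ge0 `|v - y k.+1|) => e1 e2 e3.
rewrite !le_max (distrC _ u) (distrC _ v); split; apply/orP; [left|right].
  by apply: le_sqrt => //; lra.
by apply: le_sqrt => //; lra.
Qed.

End ergodic_gap.

(** * Linear convergence of the ergodic saddle values *)

Theorem theorem4p1 (R : realType) (H1 H2 : hilbertType R)
  (K : {linear H1 -> H2}) (Ks : H2 -> H1)
  (K_cont : continuous K) (K_adj : is_adjoint K Ks)
  (g : H1 -> \bar R) (h : H2 -> \bar R)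
  (g_proper : proper_fun g) (g_lsc : lower_semicontinuous g)
  (h_proper : proper_fun h) (h_lsc : lower_semicontinuous h)
  (mu nu : R) (mu_gt0 : 0 < mu) (nu_gt0 : 0 < nu)
  (g_sc : strongly_convex mu g) (h_sc : strongly_convex nu h)
  (xs : H1) (ys : H2) (xys_saddle : saddle_point (lagrangian K g h) xs ys)
  (tau sigma alpha beta : nat -> R)
  (tau_gt0 : forall k, 0 < tau k) (sigma_gt0 : forall k, 0 < sigma k)
  (alpha_ge0 : forall k, 0 <= alpha k) (beta_ge0 : forall k, 0 <= beta k)
  (x xbar : nat -> H1) (y ybar : nat -> H2)
  (xy_gen : alternating_proximal K Ks g h tau sigma alpha beta x xbar y ybar)
  (inf_tau_gt0 : (0 < infE tau)%E) (inf_sigma_gt0 : (0 < infE sigma)%E)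
  (xi : R) (xi_gt0 : 0 < xi) (xi_lt1 : xi < 1)
  (xi_step : (xi%:E * supE tau * supE sigma * (opnorm K ^+ 2)%:E < 1)%E)
  (eta4 : R) (eta4_gt0 : 0 < eta4) (eta4_ge : (supE tau <= eta4%:E)%E)
  (eta4_lt : (0 < 1 / supE sigma - (xi * eta4 * opnorm K ^+ 2)%:E)%E)
  (eta1 eta2 eta3 : R)
  (eta1_gt0 : 0 < eta1) (eta2_gt0 : 0 < eta2) (eta3_gt0 : 0 < eta3)
  (cond_ab :
     [/\ (1 / (xi%:E * infE tau) - 1 / supE tau
           + (eta3 * opnorm K)%:E * supE (fun k => beta k ^+ 2)%R <= mu%:E)%E,
         (1 / (xi%:E * infE sigma) - 1 / supE sigma
           + (eta2 * opnorm K)%:E * supE (fun k => (xi - alpha k) ^+ 2)%R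
           <= nu%:E)%E,
         ((opnorm K * (eta1 * xi ^+ 2 + 1 / eta2))%:E
           <= xi%:E / supE tau)%E &
         ((opnorm K * (1 / eta1 + 1 / eta3))%:E <= 1 / supE sigma)%E]
     \/
     [/\ (1 / (xi%:E * infE tau) - 1 / supE tau
           + (eta3 * opnorm K ^+ 2)%:E * supE (fun k => beta k ^+ 2)%R
           <= mu%:E)%E,
         (1 / (xi%:E * infE sigma) - 1 / supE sigma
           + (eta2 * opnorm K ^+ 2)%:E * supE (fun k => (xi - alpha k) ^+ 2)%R
           <= nu%:E)%E,
         ((eta1 * opnorm K ^+ 2 * xi + 1 / (eta2 * xi))%:E
           <= 1 / supE tau)%E &
         ((1 / eta1 + 1 / eta3)%:E <= 1 / supE sigma)%E]) :
  let f := lagrangian K g h in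
  let xh := ergodic xi x in
  let yh := ergodic xi y in
  (exists2 M : R, 0 < M & forall k : nat,
     let bound1 := xi ^+ k * (1 / (2 * tau 0%N) * `|xs - x 0%N| ^+ 2
                          + 1 / (2 * sigma 0%N) * `|yh k - y 0%N| ^+ 2) in
     let bound2 := xi ^+ k * (1 / (2 * tau 0%N) * `|xh k - x 0%N| ^+ 2
                           + 1 / (2 * sigma 0%N) * `|ys - y 0%N| ^+ 2) in
     [/\ (f (xh k) (yh k) - f xs ys <= bound1%:E)%E, bound1 <= xi ^+ k * M,
         (f xs ys - f (xh k) (yh k) <= bound2%:E)%E & bound2 <= xi ^+ k * M])
  /\ linear_cvg (fun k => f (xh k) (yh k)) (f xs ys) xi.
Proof.
move=> f xh yh; pose k := opnorm K; have k0 : 0 <= k by exact: opnorm_ge0.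
have [th [thE _ tau_le]] := supE_fin eta4_ge.
(* An infinite supremum would turn the [eta4] condition into 0 < - xi eta4 ||K||^2. *)
have [sh [shE sigma_le]] :
    exists s, supE sigma = s%:E /\ forall k, sigma k <= s.
  have sigmak := le_supE sigma.
  case: (supE sigma) eta4_lt sigmak => [s|+ _|_ /(_ 0%N)]; last by rewrite leeNy_eq.
    by move=> _ sigmas; exists s; split=> // j; rewrite -lee_fin.
  rewrite div1e invey sub0e -EFinN lte_fin oppr_gt0 ltNge.
  by rewrite !mulr_ge0 ?sqr_ge0// ltW.
have [tl [tlE tl0 tau_ge]] := infE_fin inf_tau_gt0.
have [sl [slE sl0 sigma_ge]] := infE_fin inf_sigma_gt0.
have th0 : 0 < th by exact: lt_le_trans (tau_gt0 0%N) (tau_le 0%N).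
have sh0 : 0 < sh by exact: lt_le_trans (sigma_gt0 0%N) (sigma_le 0%N).
have stepK : xi * sh * (th * k ^+ 2) < 1.
  by move: xi_step; rewrite thE shE -!EFinM lte_fin -/k; lra.
rewrite thE shE tlE slE -/k in cond_ab.
have inv_fin (r : R) : 0 < r -> (1 / r%:E)%E = r^-1%:E.
  by move=> r0; rewrite div1e inver gt_eqF.
have xith : (xi%:E / th%:E)%E = (xi / th)%:E by rewrite inver gt_eqF.
(* Both cases merge: A_i = eta_i ||K||, C_i = ||K|| / eta_i under (a), and A_i = eta_i ||K||^2, C_i
   = 1 / eta_i under (b). *)
have [A1 [A2 [A3 [C1 [C2 [C3 [[A10 A20 A30] [C10 C20 C30] [AC1 AC2 AC3]
  [cmu cnu cx cy]]]]]]]] :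
  exists A1 A2 A3 C1 C2 C3 : R, [/\ [/\ 0 <= A1, 0 <= A2 & 0 <= A3],
    [/\ 0 <= C1, 0 <= C2 & 0 <= C3],
    [/\ A1 * C1 = k ^+ 2, A2 * C2 = k ^+ 2 & A3 * C3 = k ^+ 2] &
    [/\ forall j, (xi * tl)^-1 - th^-1 + A3 * beta j ^+ 2 <= mu,
        forall j, (xi * sl)^-1 - sh^-1 + A2 * (xi - alpha j) ^+ 2 <= nu,
        A1 * xi ^+ 2 + C2 <= xi / th & C1 + C3 <= sh^-1]].
  have ne1 := lt0r_neq0 eta1_gt0; have ne2 := lt0r_neq0 eta2_gt0.
  have ne3 := lt0r_neq0 eta3_gt0; have nexi := lt0r_neq0 xi_gt0.
  have e1 := ltW eta1_gt0; have e2 := ltW eta2_gt0; have e3 := ltW eta3_gt0.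
  case: cond_ab => -[cmu cnu cx cy].
    exists (eta1 * k), (eta2 * k), (eta3 * k), (k / eta1), (k / eta2), (k / eta3).
    split; split; rewrite ?mulr_ge0 ?divr_ge0 ?invr_ge0//; try (by field).
    + by apply: step_condition cmu => //; rewrite mulr_ge0.
    + by apply: step_condition cnu => //; rewrite mulr_ge0.
    + rewrite xith lee_fin in cx; apply: le_trans cx; rewrite le_eqVlt.
      by apply/orP; left; apply/eqP; field; rewrite ?ne1 ?ne2 ?ne3 ?nexi.
    + rewrite inv_fin// lee_fin in cy; apply: le_trans cy; rewrite le_eqVlt.
      by apply/orP; left; apply/eqP; field; rewrite ?ne1 ?ne2 ?ne3 ?nexi.
  exists (eta1 * k ^+ 2), (eta2 * k ^+ 2), (eta3 * k ^+ 2).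
  exists eta1^-1, eta2^-1, eta3^-1.
  split; split; rewrite ?mulr_ge0 ?sqr_ge0 ?invr_ge0//; try (by field).
  + by apply: step_condition cmu => //; rewrite ?mulr_ge0 ?sqr_ge0.
  + by apply: step_condition cnu => //; rewrite ?mulr_ge0 ?sqr_ge0.
  + move: cx; rewrite inv_fin// lee_fin -(ler_pM2l xi_gt0); apply: le_trans.
    rewrite le_eqVlt; apply/orP; left; apply/eqP; field.
    by rewrite ?ne1 ?ne2 ?ne3 ?nexi.
  + by move: cy; rewrite inv_fin// lee_fin !div1r.
have [gs hs] := saddle_fin g_proper h_proper xys_saddle.
have dom_g : exists p u, subdiff g p u.
  by exists xs, (- Ks ys); exact: saddle_subdiff_x xys_saddle.
have dom_h : exists p u, subdiff h p u.
  by exists ys, (K xs); exact: saddle_subdiff_y xys_saddle.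
have tauP j : tl <= tau j <= th by rewrite tau_ge tau_le.
have sigmaP j : sl <= sigma j <= sh by rewrite sigma_ge sigma_le.
have gap := ergodic_gap K_cont K_adj g_proper g_lsc h_proper h_lsc mu_gt0 nu_gt0
  g_sc h_sc dom_g dom_h tau_gt0 sigma_gt0 xy_gen xi_gt0 A10 A20 A30 C10 C20 C30
  AC1 AC2 AC3 tl0 sl0 tauP sigmaP stepK cmu cnu cx cy.
have bounded := apm_bounded K_cont K_adj g_proper g_lsc h_proper h_lsc mu_gt0 nu_gt0
  g_sc h_sc dom_g dom_h tau_gt0 sigma_gt0 xy_gen xi_gt0 xi_lt1
  A10 A20 A30 C10 C20 C30
  AC1 AC2 AC3 tl0 sl0 tauP sigmaP stepK cmu cnu cx cy gs hs.
have gx := apm_fin_x g_proper g_lsc mu_gt0 g_sc dom_g tau_gt0 xy_gen.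
have hy := apm_fin_y h_proper h_lsc nu_gt0 h_sc dom_h sigma_gt0 xy_gen.
have gxh : forall j, g (xh j) \is a fin_num :=
  ergodic_fin_x g_proper g_lsc mu_gt0 g_sc dom_g tau_gt0 xy_gen xi_gt0.
have hyh : forall j, h (yh j) \is a fin_num :=
  ergodic_fin_y h_proper h_lsc nu_gt0 h_sc dom_h sigma_gt0 xy_gen xi_gt0.
have saddle u v := saddle_le g_proper h_proper xys_saddle (u := u) (v := v).
(* At the saddle point F(x, ys) >= F(xs, ys) >= F(xs, y), so every gap is nonnegative. *)
have [j|B xyB] := bounded.
  have /andP[+ _] := saddle _ _ gs (hy j); have /andP[_] := saddle _ _ (gx j) hs.
  by rewrite subr_ge0 => le1 le2; exact: le_trans le2 le1.
have xhB j : `|xh j - xs| <= B by apply: ergodic_dist => // i; exact: (xyB i).1.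
have yhB j : `|yh j - ys| <= B by apply: ergodic_dist => // i; exact: (xyB i).2.
have B0 : 0 <= B := le_trans (normr_ge0 _) (xhB 0%N).
pose Bx := B + `|xs - x 0%N|; pose By := B + `|ys - y 0%N|.
have xhx0 j : `|xh j - x 0%N| <= Bx.
  rewrite -[xh j](subrK xs) -addrA; apply: (le_trans (ler_normD _ _)).
  by rewrite lerD2r.
have yhy0 j : `|yh j - y 0%N| <= By.
  rewrite -[yh j](subrK ys) -addrA; apply: (le_trans (ler_normD _ _)).
  by rewrite lerD2r.
have xsx0 : `|xs - x 0%N| <= Bx by rewrite lerDr.
have ysy0 : `|ys - y 0%N| <= By by rewrite lerDr.
pose dist u v := 1 / (2 * tau 0%N) * `|u - x 0%N| ^+ 2
  + 1 / (2 * sigma 0%N) * `|v - y 0%N| ^+ 2.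
have distE u v : initial_gap tau sigma x y u v = dist u v.
  by rewrite /initial_gap /dist !div1r !invfM ![2^-1 * _]mulrC.
(* The summand 1 keeps [M] positive even if all distances vanish. *)
pose M := 1 / (2 * tau 0%N) * Bx ^+ 2 + 1 / (2 * sigma 0%N) * By ^+ 2 + 1.
have itau0 : 0 <= 1 / (2 * tau 0%N) by rewrite divr_ge0// mulr_ge0// ltW.
have isigma0 : 0 <= 1 / (2 * sigma 0%N) by rewrite divr_ge0// mulr_ge0// ltW.
have M0 : 0 < M by rewrite ltr_wpDl// addr_ge0// mulr_ge0// sqr_ge0.
have xi_ge0 j : 0 <= xi ^+ j by rewrite exprn_ge0// ltW.
have distM j u v : `|u - x 0%N| <= Bx -> `|v - y 0%N| <= By ->
    xi ^+ j * dist u v <= xi ^+ j * M.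
  move=> uB vB; rewrite ler_wpM2l// /M ler_wpDr// lerD// ler_wpM2l//.
    by rewrite lerXn2r ?nnegrE ?addr_ge0.
  by rewrite lerXn2r ?nnegrE ?addr_ge0.
pose F := real_lagrangian K g h.
have fE j : f (xh j) (yh j) = (F (xh j) (yh j))%:E by exact: lagrangian_fin.
have fsE : f xs ys = (F xs ys)%:E by exact: lagrangian_fin.
(* The gap is taken at (xs, yh_j), and F(xs, yh_j) <= F(xs, ys). *)
have le1 j : F (xh j) (yh j) - F xs ys <= xi ^+ j * dist xs (yh j).
  have /andP[+ _] := saddle _ _ gs (hyh j); have := gap _ _ j gs (hyh j).
  by rewrite distE /F /xh /yh; lra.
have le2 j : F xs ys - F (xh j) (yh j) <= xi ^+ j * dist (xh j) ys.
  have /andP[_] := saddle _ _ (gxh j) hs; have := gap _ _ j (gxh j) hs.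
  by rewrite distE /F /xh /yh; lra.
have rate j : `|F (xh j) (yh j) - F xs ys| <= M * xi ^+ j.
  rewrite ler_norml mulrC lerNl opprB (le_trans (le1 j)) ?distM//.
  by rewrite (le_trans (le2 j)) ?distM.
split.
  exists M => // j /=; rewrite fE fsE -!EFinB !lee_fin.
  by split; [exact: le1 | exact: distM | exact: le2 | exact: distM].
split; first by rewrite xi_gt0.
  rewrite fsE; under eq_fun do rewrite fE.
  apply: cvg_EFin; first exact: nearW.
  apply: (@cvg_dist_le R R^o _ _ (fun j => M * xi ^+ j)) => //.
  rewrite -[0](mulr0 M); apply: cvgMr; apply: cvg_expr.
  by rewrite ger0_norm// ltW.
by exists M => // j; rewrite fE fsE -EFinB abse_EFin lee_fin.
Qed.
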